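(* Let $\Pi$ be a point process on $\mathbb{R}^d$ and let $S\subseteq\mathbb{R}^d$ be a Borel set with finite nonzero Lebesgue measure. If $\Pi$ is insertion-tolerant, and $U$ is uniformly distributed in $S$ and independent of $\Pi$, then $\Pi+\delta_U$ is insertion-tolerant.
   Context: Point processes are always simple and locally finite, i.e. random elements of the space $\mathbb{M}$ of simple locally finite point measures on $\mathbb{R}^d$, equipped with the $\sigma$-field generated by the evaluations $\mu\mapsto\mu(A)$, $A$ Borel. For random variables $X,Y$ with values in the same measurable space, $X\prec Y$ means that $\mathbb{P}(Y\in\mathcal{A})=0$ implies $\mathbb{P}(X\in\mathcal{A})=0$ for all measurable $\mathcal{A}$. For $x\in\mathbb{R}^d$, $\delta_x$ is the point measure at $x$. A point process $\Pi$ is insertion-tolerant if for every Borel set $S\subseteq\mathbb{R}^d$ with Lebesgue measure in $(0,\infty)$, if $U$ is uniformly distributed on $S$ and independent of $\Pi$, then $\Pi+\delta_U\prec\Pi$. *)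

(* Defs.v *)
From HB Require Import structures.
From mathcomp Require Import all_boot all_order all_algebra.
From mathcomp Require Import all_classical all_reals all_analysis.
From mathcomp Require Import measurable_realfun.

Set Implicit Arguments.
Unset Strict Implicit.
Unset Printing Implicit Defensive.

Import Order.TTheory GRing.Theory Num.Theory.
Import numFieldNormedType.Exports.

Local Open Scope classical_set_scope.
Local Open Scope ring_scope.
Local Open Scope ereal_scope.

(* R^d; the measurable sets of the tuple type are generated by the coordinate
   maps, hence are exactly the Borel sets. *)
Notation euclidean R d := (d.-tuple (measurableTypeR R)).

Section lebesgue_euclidean.
Context (R : realType).

Definition cons_coord d (p : euclidean R d * measurableTypeR R) :
  euclidean R d.+1 := [the d.+1.-tuple _ of p.2 :: p.1].

Lemma measurable_cons_coord d : measurable_fun setT (@cons_coord d).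
Proof. exact: measurable_cons. Qed.

Definition lebesgue_step d (mu : {measure set (euclidean R d) -> \bar R}) :
    set (euclidean R d.+1) -> \bar R :=
  pushforward (mu \x @lebesgue_measure R) (@cons_coord d).

Section lebesgue_step_measure.
Context d (mu : {measure set (euclidean R d) -> \bar R}).

Let lebesgue_step0 : lebesgue_step mu set0 = 0.
Proof. by rewrite /lebesgue_step /pushforward preimage_set0 measure0. Qed.

Let lebesgue_step_ge0 A : 0 <= lebesgue_step mu A.
Proof. by rewrite /lebesgue_step /pushforward; apply: measure_ge0. Qed.

Let lebesgue_step_sigma_additive : semi_sigma_additive (lebesgue_step mu).
Proof.
apply: (@measure_semi_sigma_additive _ _ _ (pushforward _ _)).
exact: measurable_cons_coord.
Qed.

HB.instance Definition _ := isMeasure.Build _ _ _ (lebesgue_step mu)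
  lebesgue_step0 lebesgue_step_ge0 lebesgue_step_sigma_additive.

End lebesgue_step_measure.

(* d-dimensional Lebesgue measure, as an iterated product measure *)
Fixpoint lebesgue_euclidean d : {measure set (euclidean R d) -> \bar R} :=
  match d with
  | 0%N => \d_([tuple] : euclidean R 0)
  | d'.+1 => lebesgue_step (lebesgue_euclidean d')
  end.

Lemma lebesgue_euclidean_box d (A : 'I_d -> set (measurableTypeR R)) :
  (forall i, measurable (A i)) ->
  lebesgue_euclidean d [set x | forall i, A i (tnth x i)] =
  \prod_(i < d) lebesgue_measure (A i).
Proof.
elim: d A => [|d ih] A mA /=.
  by rewrite big_ord0 diracE mem_set//= => -[].
rewrite big_ord_recl -ih//= /lebesgue_step /pushforward.
rewrite [X in (_ \x _) X](_ : _ =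
  [set x | forall i, A (lift ord0 i) (tnth x i)] `*` A ord0); last first.
  apply/seteqP; split=> [[x y]/= h|[x y]/= [h h0] i].
    split=> [i|]; last by have := h ord0; rewrite tnth0.
    by have := h (lift ord0 i); rewrite tnthS.
  case: (unliftP ord0 i) => [j ->|->]; rewrite ?tnth0 ?tnthS//; exact: h.
rewrite product_measure1E//; first by rewrite muleC.
rewrite [X in measurable X](_ : _ =
  \bigcap_i ((@tnth d _ ^~ i) @^-1` A (lift ord0 i))); last first.
  by apply/seteqP; split=> x /= h i; [move=> _|]; exact: h.
apply: fin_bigcap_measurable => // i _.
rewrite -[X in measurable X]setTI; exact: measurable_tnth.
Qed.

End lebesgue_euclidean.

Section measures.
Context d (T : measurableType d) (R : realType).

Definition measures : Type := {measure set T -> \bar R}.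

HB.instance Definition _ := gen_eqMixin measures.
HB.instance Definition _ := gen_choiceMixin measures.
HB.instance Definition _ := isPointed.Build measures (@mzero d T R).

Definition evaluation (A : set T) (mu : measures) : \bar R := mu A.

(* sigma-algebra generated by the evaluations mu |-> mu A, A measurable *)
Definition measures_measurable : set_system measures :=
  <<s \bigcup_(A in measurable)
        preimage_set_system setT (evaluation A)
          measurable >>.

Let measures_measurable0 : measures_measurable set0.
Proof. exact: sigma_algebra0. Qed.

Let measures_measurableC (A : set measures) :
  measures_measurable A -> measures_measurable (~` A).
Proof. exact: sigma_algebraC. Qed.

Let measures_measurableU (F : (set measures)^nat) :
  (forall i, measures_measurable (F i)) ->
  measures_measurable (\bigcup_i F i).
Proof. exact: sigma_algebra_bigcup. Qed.

Definition measures_display : measure_display.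
Proof. by constructor. Qed.

HB.instance Definition _ :=
  @isMeasurable.Build measures_display measures measures_measurable
    measures_measurable0 measures_measurableC measures_measurableU.

Lemma measurable_evaluation (A : set T) : measurable A ->
  measurable_fun [set: measures] (evaluation A).
Proof.
move=> mA _ B mB; apply: sub_sigma_algebra.
by exists A => //; exists B.
Qed.

Lemma measurable_to_measures d' (Omega : measurableType d')
    (X : Omega -> measures) :
  (forall A, measurable A -> measurable_fun setT (fun w => X w A)) ->
  measurable_fun setT X.
Proof.
move=> mX; apply: (measurability
  (\bigcup_(A in measurable)
     preimage_set_system setT (evaluation A)
          measurable)) => //.
move=> _ [_ [A mA [B mB <-]] <-].
by rewrite setTI; exact: mX.
Qed.

End measures.

Section random_elements.
Context (R : realType).

(* X \prec Y; X and Y may live on different probability spaces *)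
Definition law_dominated d d1 d2 (T : measurableType d)
    (Omega1 : measurableType d1) (P1 : probability Omega1 R)
    (X : {mfun Omega1 >-> T})
    (Omega2 : measurableType d2) (P2 : probability Omega2 R)
    (Y : {mfun Omega2 >-> T}) : Prop :=
  forall A : set T, measurable A -> P2 (Y @^-1` A) = 0 -> P1 (X @^-1` A) = 0.

Definition same_law d d1 d2 (T : measurableType d)
    (Omega1 : measurableType d1) (P1 : probability Omega1 R)
    (X : {mfun Omega1 >-> T})
    (Omega2 : measurableType d2) (P2 : probability Omega2 R)
    (Y : {mfun Omega2 >-> T}) : Prop :=
  forall A : set T, measurable A -> P1 (X @^-1` A) = P2 (Y @^-1` A).

Definition independent d d1 d2 (Omega : measurableType d)
    (P : probability Omega R) (T1 : measurableType d1)
    (T2 : measurableType d2) (X : {mfun Omega >-> T1})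
    (Y : {mfun Omega >-> T2}) : Prop :=
  forall (A : set T1) (B : set T2), measurable A -> measurable B ->
    P (X @^-1` A `&` Y @^-1` B) = P (X @^-1` A) * P (Y @^-1` B).

End random_elements.

Section point_processes.
Context (R : realType) (d : nat).
Local Notation E := (euclidean R d).

Definition bounded_subset (A : set E) : Prop :=
  exists M : R, forall x, A x -> forall i, (`|tnth x i| <= M)%R.

Definition locally_finite (mu : measures E R) : Prop :=
  forall A, measurable A -> bounded_subset A -> mu A < +oo.

(* mu is the sum of the Dirac masses at the points of a countable set D.  Only
   measurable sets are considered: the values of a measure on other sets carry
   no information. *)
Definition simple_point_measure (mu : measures E R) : Prop :=
  exists2 D : set E, countable D &
    forall A, measurable A -> mu A = \esum_(x in D) \d_x A.

(* A random element of the space of simple locally finite point measures, up to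
   null events: X + \delta_U is simple only almost surely, so X takes its values
   in the ambient space of all measures.  As the sigma-field on the point
   measures is the trace of the one on all measures, absolute continuity of
   laws means the same in both spaces. *)
Definition point_process dO (Omega : measurableType dO)
    (P : probability Omega R) (X : {mfun Omega >-> measures E R}) : Prop :=
  {ae P, forall w, simple_point_measure (X w) /\ locally_finite (X w)}.

Definition uniform_on dO (Omega : measurableType dO) (P : probability Omega R)
    (S : set E) (U : {mfun Omega >-> E}) : Prop :=
  forall A, measurable A ->
    P (U @^-1` A) =
    lebesgue_euclidean R d (A `&` S) / lebesgue_euclidean R d S.

Section add_point.
Context dO (Omega : measurableType dO).
Variables (X : {mfun Omega >-> measures E R}) (U : {mfun Omega >-> E}).

Definition add_point (w : Omega) : measures E R :=
  measure_add (X w) (\d_(U w)).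

Let measurable_add_point : measurable_fun setT add_point.
Proof.
apply: measurable_to_measures => A mA.
have -> : (fun w => add_point w A) = (fun w => X w A + \d_(U w) A).
  by apply/funext => w; exact: measure_addE.
apply: emeasurable_funD.
  apply: (measurableT_comp (measurable_evaluation mA)).
  exact: measurable_funPT.
exact: (measurable_kernel (kdirac (measurable_funPT U))).
Qed.

HB.instance Definition _ :=
  isMeasurableFun.Build _ _ _ _ add_point measurable_add_point.

End add_point.

(* Insertion-tolerance is a property of the law of X: the space carrying X need
   not be rich enough to carry an independent U, so X is replaced by any copy
   X' of it on a space that does. *)
Definition insertion_tolerant dO (Omega : measurableType dO)
    (P : probability Omega R) (X : {mfun Omega >-> measures E R}) : Prop :=
  forall S : set E, measurable S ->
  0 < lebesgue_euclidean R d S -> lebesgue_euclidean R d S < +oo ->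
  forall dO' (Omega' : measurableType dO') (P' : probability Omega' R)
    (X' : {mfun Omega' >-> measures E R}) (U : {mfun Omega' >-> E}),
  same_law P' X' P X -> uniform_on P' S U -> independent P' X' U ->
  law_dominated P' (add_point X' U) P X.

End point_processes.

(* Main.v *)
From HB Require Import structures.
Require Import Defs.
From mathcomp Require Import all_boot all_order all_algebra.
From mathcomp Require Import all_classical all_reals all_analysis.
From mathcomp Require Import measurable_realfun.

Set Implicit Arguments.
Unset Strict Implicit.
Unset Printing Implicit Defensive.

Import Order.TTheory GRing.Theory Num.Theory.

Local Open Scope classical_set_scope.
Local Open Scope ring_scope.
Local Open Scope ereal_scope.

(** Insertion-tolerance is stable under inserting a uniform point because
    insertions commute.  Write [I L u] ([insertion_law]) for the law of
    [mu + delta_x] when [mu] has law [L] and [x], independent of [mu], has law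
    [u].  Two facts about [I] suffice: it is monotone for absolute continuity
    in its first argument ([insertion_law_dominated]), and
    [I (I L u) v = I (I L v) u] ([insertion_lawC]).  Let [L] be the law of [Pi],
    [u] the law of [U] and [v] the uniform law on another set [T].  Tolerance of
    [Pi] gives [I L v << L], hence
      [I (I L u) v = I (I L v) u << I L u],
    which says that [Pi + delta_U] tolerates the insertion of a uniform point
    of [T].

    That [Pi + delta_U] is again almost surely simple means that [U] almost
    surely misses the atoms of [Pi].  In dimension at least one the law of [U]
    has no atoms.  A fixed sigma-finite measure [m] then gives mass zero to
    [{y}] for almost every [y], as Tonelli's theorem on the diagonal shows
    ([atomless_atoms_null]); integrating over the law of [Pi], which is
    independent of [U], gives [Pi {U} = 0] almost surely
    ([independent_atomless_null]).  Joint measurability of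
    [(mu, x) |-> mu {x}] is obtained by truncating [mu] to a finite kernel
    ([truncated_restriction]).

    In dimension zero the space is one point and [U] is constant, but there no
    insertion-tolerant point process exists: it would have at most one point,
    whereas the total mass of an insertion-tolerant random measure cannot be
    almost surely bounded, since each insertion would lower the bound by one
    ([insertion_tolerant_unbounded]). *)

(** * Product measures and joint laws *)

Lemma product_measure_iterated d1 d2 (T1 : measurableType d1)
    (T2 : measurableType d2) (R : realType)
    (m1 : {sigma_finite_measure set T1 -> \bar R})
    (m2 : {sigma_finite_measure set T2 -> \bar R}) (B : set (T1 * T2)) :
  measurable B -> (m1 \x m2) B = \int[m2]_y m1 (ysection B y).
Proof.
move=> mB; rewrite -[RHS]/((m1 \x^ m2) B).
apply: (product_measure_unique (m' := m1 \x^ m2)) mB => *.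
exact: product_measure2E.
Qed.

(** A set is null for the product iff almost all its sections are null, and
    the exceptional set of first coordinates is a measurable null set of the
    first factor: it stays null for every measure that the factor dominates. *)
Lemma product_measure_dominatedl d1 d2 (T1 : measurableType d1)
    (T2 : measurableType d2) (R : realType)
    (m1 m1' : {measure set T1 -> \bar R})
    (m2 : {sigma_finite_measure set T2 -> \bar R}) (B : set (T1 * T2)) :
  (forall A, measurable A -> m1 A = 0 -> m1' A = 0) ->
  measurable B -> (m1 \x m2) B = 0 -> (m1' \x m2) B = 0.
Proof.
move=> m1m1' mB.
have mf := measurable_fun_xsection m2 mB.
have msupp : measurable [set x | m2 (xsection B x) != 0].
  rewrite -[X in measurable X]setTI.
  apply: (mf measurableT [set y | y != 0]).
  rewrite [X in measurable X](_ : _ = ~` [set 0]); first exact: measurableC.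
  by apply/seteqP; split => x /= /eqP.
have null (m : {measure set T1 -> \bar R}) :
    (m \x m2) B = 0 <-> m [set x | m2 (xsection B x) != 0] = 0.
  have -> : (m \x m2) B = \int[m]_(x in setT) `|(m2 \o xsection B) x|.
    by apply: eq_integral => x _; rewrite gee0_abs.
  apply: iff_trans (ae_eq_integral_abs m measurableT mf) _.
  apply: iff_trans (negligibleP m msupp).
  split; apply: negligibleS => x /=.
    by move=> /eqP Bx0 /(_ Logic.I).
  by move=> h; apply/eqP => Bx; apply: h.
by move=> /null/(m1m1' _ msupp)/null.
Qed.

Section joint_distribution.
Context (R : realType) d d1 d2 (Omega : measurableType d)
  (T1 : measurableType d1) (T2 : measurableType d2).
Variables (P : probability Omega R).
Variables (X : {mfun Omega >-> T1}) (Y : {mfun Omega >-> T2}).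

Lemma joint_distribution (B : set (T1 * T2)) :
  independent P X Y -> measurable B ->
  P [set w | B (X w, Y w)] = (distribution P X \x distribution P Y) B.
Proof.
move=> XY mB.
have mXY : measurable_fun setT (fun w => (X w, Y w)).
  by apply/measurable_fun_pair => //; exact: measurable_funPT.
pose mixin := isMeasurableFun.Build _ _ _ _ _ mXY.
pose XYf : {mfun Omega >-> (T1 * T2)%type} :=
  HB.pack (fun w => (X w, Y w)) mixin.
apply: esym; apply: (product_measure_unique (m' := distribution P XYf)) mB.
by move=> A1 A2 mA1 mA2; rewrite -XY.
Qed.

End joint_distribution.

(** * The law of a configuration with an independent point inserted *)

Section insertion_law.
Context (R : realType) (d : nat).
Local Notation E := (euclidean R d).
Local Notation M := (measures E R).

(** The coordinates of the canonical space carrying an independent pair, a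
    random measure and a random point, bundled as measurable functions. *)
Definition configuration : {mfun (M * E)%type >-> M} :=
  HB.pack (@fst M E)
    (isMeasurableFun.Build _ _ _ _ _ (@measurable_fst _ _ M E)).

Definition new_point : {mfun (M * E)%type >-> E} :=
  HB.pack (@snd M E)
    (isMeasurableFun.Build _ _ _ _ _ (@measurable_snd _ _ M E)).

Definition insertion : {mfun (M * E)%type >-> M} :=
  add_point configuration new_point.

Lemma insertionE (p : M * E) (A : set E) :
  insertion p A = (p.1 : M) A + \d_(p.2) A.
Proof. exact: measure_addE. Qed.

Lemma insertionAC (mu : M) (x y : E) :
  insertion (insertion (mu, x), y) = insertion (insertion (mu, y), x).
Proof.
by apply: eq_measure; apply/funext => A; rewrite !insertionE /= addeAC.
Qed.

Definition insertion_law (L : probability M R) (u : probability E R) :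
  probability M R := distribution (L \x u) insertion.

Lemma measurable_insertion (A : set M) :
  measurable A -> measurable (insertion @^-1` A).
Proof.
by move=> mA; rewrite -[X in measurable X]setTI; exact: measurable_funPT.
Qed.

Lemma distribution_add_point dO (Omega : measurableType dO)
    (P : probability Omega R) (X : {mfun Omega >-> M}) (U : {mfun Omega >-> E})
    (A : set M) :
  independent P X U -> measurable A ->
  P (add_point X U @^-1` A) =
  insertion_law (distribution P X) (distribution P U) A.
Proof.
move=> XU mA.
exact: (joint_distribution XU (measurable_insertion mA)).
Qed.

Lemma insertion_law_dominated (L L' : probability M R) (u : probability E R) :
  (forall A, measurable A -> L A = 0 -> L' A = 0) ->
  forall A, measurable A -> insertion_law L u A = 0 -> insertion_law L' u A = 0.
Proof.
move=> LL' A mA; apply: product_measure_dominatedl => //.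
exact: measurable_insertion.
Qed.

(** Both sides integrate, over the two inserted points [x] and [y], the
    probability under [L] that [mu + delta_x + delta_y] lies in [A]; this
    probability is symmetric in [x] and [y], so that Tonelli's theorem
    concludes. *)
Lemma insertion_lawC (L : probability M R) (u v : probability E R) (A : set M) :
  measurable A ->
  insertion_law (insertion_law L u) v A = insertion_law (insertion_law L v) u A.
Proof.
move=> mA.
pose B : set (M * (E * E)) :=
  [set q | A (insertion (insertion (q.1, q.2.1), q.2.2))].
have mB : measurable B.
  have mins : measurable_fun setT insertion by exact: measurable_funPT.
  rewrite -[X in measurable X]setTI.
  apply: (measurableT_comp mins) => //.
  apply/measurable_fun_pair => /=; last exact: measurableT_comp.
  apply: (measurableT_comp mins).
  by apply/measurable_fun_pair => //=; exact: measurableT_comp.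
pose h (xy : E * E) := L (ysection B xy).
have mh : measurable_fun setT h by exact: measurable_fun_ysection.
have hE (u' v' : probability E R) :
    insertion_law (insertion_law L u') v' A = \int[v']_y \int[u']_x h (x, y).
  rewrite -[LHS]/((insertion_law L u' \x v') (insertion @^-1` A)).
  rewrite product_measure_iterated; last exact: measurable_insertion.
  apply: eq_integral => y _.
  rewrite -[LHS]/((L \x u')
    (insertion @^-1` ysection (insertion @^-1` A) y)).
  rewrite product_measure_iterated; last first.
    apply: measurable_insertion; apply: measurable_ysection.
    exact: measurable_insertion.
  apply: eq_integral => x _; congr (L _).
  by apply/seteqP; split => mu; rewrite /ysection /= !inE /= ?inE.
have hC x y : h (x, y) = h (y, x).
  congr (L _); apply/seteqP.
  by split => mu; rewrite /ysection/= !inE /B /= insertionAC.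
have h0 xy : 0 <= h xy by exact: measure_ge0.
apply: (etrans (hE u v)); apply/esym; apply: (etrans (hE v u)); apply/esym.
move: (h) mh hC h0 => {hE h mB B} g mg gC g0.
rewrite -(fubini_tonelli g mg g0).
by apply: eq_integral => x _; apply: eq_integral => y _; rewrite gC.
Qed.

End insertion_law.

Arguments configuration {R d}.
Arguments new_point {R d}.
Arguments insertion {R d}.

(** * Insertion-tolerance *)

Section tolerance.
Context (R : realType) (d : nat).
Local Notation E := (euclidean R d).
Local Notation M := (measures E R).

(** Insertion-tolerance as absolute continuity of laws, obtained by
    realizing the independent pair on the product space of the two laws. *)
Lemma insertion_tolerant_law dO (Omega : measurableType dO)
    (P : probability Omega R) (X : {mfun Omega >-> M})
    dO' (Omega' : measurableType dO') (P' : probability Omega' R)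
    (T : set E) (V : {mfun Omega' >-> E}) :
  insertion_tolerant P X -> measurable T ->
  0 < lebesgue_euclidean R d T -> lebesgue_euclidean R d T < +oo ->
  uniform_on P' T V ->
  forall A, measurable A -> distribution P X A = 0 ->
  insertion_law (distribution P X) (distribution P' V) A = 0.
Proof.
move=> tolX mT T0 Too unifV.
have law1 (A : set M) : measurable A ->
    (distribution P X \x distribution P' V) (configuration @^-1` A) =
    distribution P X A.
  move=> mA; rewrite -[_ @^-1` A]/(fst @^-1` A) -setXT product_measure1E//.
  by rewrite [X in _ * X](probability_setT (distribution P' V)) mule1.
have law2 (B : set E) : measurable B ->
    (distribution P X \x distribution P' V) (new_point @^-1` B) =
    distribution P' V B.
  move=> mB; rewrite -[_ @^-1` B]/(snd @^-1` B) -setTX product_measure1E//.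
  by rewrite [X in X * _](probability_setT (distribution P X)) mul1e.
apply: (tolX T mT T0 Too _ _ (distribution P X \x distribution P' V)
  configuration new_point).
- exact: law1.
- by move=> B mB; apply: (etrans (law2 B mB)); exact: unifV.
- move=> A B mA mB.
  apply: (etrans (product_measure1E (distribution P X) (distribution P' V)
    mA mB)).
  by apply/esym; congr (_ * _); [exact: law1|exact: law2].
Qed.

Lemma insertion_tolerant_add_point dO (Omega : measurableType dO)
    (P : probability Omega R) (X : {mfun Omega >-> M})
    (U : {mfun Omega >-> E}) :
  insertion_tolerant P X -> independent P X U ->
  insertion_tolerant P (add_point X U).
Proof.
move=> tolX XU T mT T0 Too dO' Omega' P' X' V X'E unifV X'V A mA A0.
rewrite (distribution_add_point X'V mA).
have X'dom B : measurable B ->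
    insertion_law (distribution P X) (distribution P U) B = 0 ->
    distribution P' X' B = 0.
  by move=> mB; rewrite -(distribution_add_point XU mB) -(X'E _ mB).
apply: (insertion_law_dominated X'dom) => //.
rewrite insertion_lawC//.
have ILv := insertion_tolerant_law tolX mT T0 Too unifV.
apply: (insertion_law_dominated ILv) => //.
by rewrite -(distribution_add_point XU mA).
Qed.

(** If the mass of [X] were almost surely less than [n + 1], so would be the
    mass of [X] plus one more point, by tolerance; hence the mass of [X] would
    be almost surely less than [n].  For [n = 0] the event has probability
    one. *)
Lemma insertion_tolerant_unbounded dO (Omega : measurableType dO)
    (P : probability Omega R) (X : {mfun Omega >-> M}) (U : {mfun Omega >-> E})
    (S : set E) (n : nat) :
  insertion_tolerant P X -> measurable S ->
  0 < lebesgue_euclidean R d S -> lebesgue_euclidean R d S < +oo ->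
  uniform_on P S U -> independent P X U ->
  P [set w | n%:R%:E <= (X w : M) setT] != 0.
Proof.
move=> tolX mS S0 Soo unifU XU; elim: n => [|n].
  rewrite (_ : [set _ | _] = setT); last first.
    by apply/seteqP; split => // w _; exact: measure_ge0.
  by rewrite probability_setT onee_neq0.
apply: contra_neq => null.
have mA : measurable [set mu : M | n.+1%:R%:E <= (mu : M) setT].
  rewrite -[X in measurable X]setTI.
  exact: (emeasurable_fun_c_infty _ (measurable_evaluation measurableT)).
have := tolX S mS S0 Soo _ _ P X U (fun _ _ => erefl) unifU XU _ mA null.
congr (P _ = 0); apply/seteqP.
have addE w : (add_point X U w : M) setT = (X w : M) setT + 1.
  by rewrite [LHS]measure_addE [X in _ + X]diracT.
by split => w /=; rewrite addE -natr1 EFinD leeD2rE.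
Qed.

End tolerance.

(** * Atoms charged by an independent point with an atomless law *)

Section diagonal.
Context (R : realType) (d : nat).
Local Notation E := (euclidean R d).

Lemma measurable_coincidence d' (Z : measurableType d') (f g : Z -> E) :
  measurable_fun setT f -> measurable_fun setT g ->
  measurable [set z | f z = g z].
Proof.
move=> mf mg.
rewrite (_ : [set _ | _] =
    \bigcap_(i in [set: 'I_d]) [set z | tnth (f z) i == tnth (g z) i]);
    last first.
  apply/seteqP; split => [z /= fg i _ /=|z fg /=]; first by rewrite fg.
  by apply: eq_from_tnth => i; apply/eqP; exact: fg.
apply: fin_bigcap_measurable => // i _.
rewrite -[X in measurable X]setTI.
have mcoord (h : Z -> E) : measurable_fun setT h ->
    measurable_fun setT (fun z => tnth (h z) i : R).
  exact: (measurableT_comp (measurable_tnth i)).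
exact: (measurable_fun_eqr (mcoord _ mf) (mcoord _ mg) measurableT
  (_ : measurable [set true])).
Qed.

Lemma measurable_point (x : E) : measurable [set x].
Proof.
have -> : [set x] = [set y | id y = cst x y] by [].
by apply: measurable_coincidence.
Qed.

(** The diagonal is null for [u \x m], because its sections over the second
    coordinate are single points, null for [u]; hence almost all its sections
    over the first coordinate are null for [m]. *)
Lemma atomless_atoms_null (u : probability E R)
    (m : {sigma_finite_measure set E -> \bar R}) :
  (forall x, u [set x] = 0) ->
  u [set y | m [set y] != 0] = 0.
Proof.
move=> u0.
pose D := [set p : E * E | p.1 = p.2].
have mD : measurable D by exact: measurable_coincidence.
have xD x : xsection D x = [set x].
  by apply/seteqP; split => y; rewrite /xsection /= inE /D /= => ->.
have yD x : ysection D x = [set x].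
  by apply/seteqP; split => y; rewrite /ysection /= inE /D /= => ->.
have D0 : (u \x m) D = 0.
  rewrite product_measure_iterated//; apply: integral0_eq => y _.
  by rewrite yD; exact: u0.
have mf := measurable_fun_xsection m mD.
have {}D0 : \int[u]_(x in setT) `|(m \o xsection D) x| = 0.
  by rewrite -D0; apply: eq_integral => x _; rewrite gee0_abs.
have/ae_eq_integral_abs := D0 => /(_ measurableT mf) h.
apply/negligibleP; last first.
  apply: negligibleS h => y /= my0 /(_ Logic.I); rewrite xD => my.
  by rewrite my eqxx in my0.
rewrite -[X in measurable X]setTI.
rewrite (_ : [set _ | _] = (m \o xsection D) @^-1` [set~ 0]).
  by apply: mf => //; exact: measurableC.
by apply/seteqP; split => y /=; rewrite xD => /eqP.
Qed.

End diagonal.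

Section truncated_restriction.
Context (R : realType) (d : nat).
Local Notation E := (euclidean R d).
Local Notation M := (measures E R).
Variables (W : set E) (mW : measurable W) (b : R).

(** A locally finite measure is only finite on bounded sets, with no uniform
    bound, so that [mu |-> mu] is not a finite kernel; restricting [mu] to a
    window, and discarding it when the window has mass above [b], makes it one.
    Taking the whole pair as parameter makes the mass of the random point [p.2]
    the mass of the section over [p] of a measurable set. *)
Definition truncated_restriction (p : M * E) : {measure set E -> \bar R} :=
  if (p.1 : M) W <= b%:E
  then [the {measure set E -> \bar R} of mrestr (p.1 : M) mW]
  else [the {measure set E -> \bar R} of mzero].

Let measurable_truncated_restriction (A : set E) : measurable A ->
  measurable_fun setT (truncated_restriction ^~ A).
Proof.
move=> mA.
have mev (B : set E) : measurable B ->
    measurable_fun setT (fun p : M * E => (p.1 : M) B).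
  move=> mB; apply: (measurableT_comp (measurable_evaluation mB)).
  exact: measurable_fst.
rewrite (_ : (truncated_restriction ^~ A) = fun p : M * E =>
    if (p.1 : M) W <= b%:E then (p.1 : M) (A `&` W) else 0); last first.
  by apply/funext => p; rewrite /truncated_restriction; case: ifP.
apply: measurable_fun_ifT => //.
  by apply: measurable_fun_lee => //; exact: mev.
by apply: mev; exact: measurableI.
Qed.

HB.instance Definition _ := isKernel.Build _ _ _ _ _ truncated_restriction
  measurable_truncated_restriction.

Let truncated_restriction_uub : measure_fam_uub truncated_restriction.
Proof.
exists (`|b| + 1)%R => p; rewrite /truncated_restriction.
case: ifPn => [Wb|_]; last by rewrite /mzero lte_fin ltr_wpDl.
rewrite /= /mrestr setTI (le_lt_trans Wb)// lte_fin.
by rewrite (le_lt_trans (ler_norm b))// ltrDl.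
Qed.

HB.instance Definition _ := Kernel_isFinite.Build _ _ _ _ _
  truncated_restriction truncated_restriction_uub.

Lemma truncated_restriction_null (L : probability M R) (u : probability E R) :
  (forall x, u [set x] = 0) ->
  measurable [set p | truncated_restriction p [set p.2] != 0] /\
  (L \x u) [set p | truncated_restriction p [set p.2] != 0] = 0.
Proof.
move=> u0.
set B := [set p | _].
have mB : measurable B.
  pose D := [set q : (M * E) * E | q.1.2 = q.2].
  have mD : measurable D.
    apply: measurable_coincidence => //.
    exact: (measurableT_comp (f := snd) (g := fst)).
  have := measurable_fun_xsection_finite_kernel truncated_restriction.
  move=> /(_ D); rewrite inE => /(_ mD) mk.
  rewrite -[X in measurable X]setTI.
  rewrite (_ : B =
    (fun p => truncated_restriction p (xsection D p)) @^-1` [set~ 0]).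
    by apply: mk => //; exact: measurableC.
  have xD p : xsection D p = [set p.2].
    by apply/seteqP; split => y; rewrite /xsection /= inE /D /= => ->.
  by apply/seteqP; split => p; rewrite /B /= xD => /eqP.
split => //; apply: integral0_eq => mu _ /=.
have [Wb|Wb] := boolP ((mu : M) W <= b%:E).
  have Woo : (mu : M) W < +oo by exact: le_lt_trans Wb (ltry _).
  rewrite (_ : xsection B mu = [set y | mfrestr mW Woo [set y] != 0]).
    exact: atomless_atoms_null.
  apply/seteqP; split => y; rewrite /xsection /= inE /B /=;
    by rewrite /truncated_restriction /= Wb.
rewrite (_ : xsection B mu = set0) ?measure0//.
apply/seteqP; split => y //; rewrite /xsection /= inE /B /=.
by rewrite /truncated_restriction /= (negbTE Wb) /mzero eqxx.
Qed.

End truncated_restriction.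

(** * Simplicity and local finiteness after an insertion *)

Section point_process_add_point.
Context (R : realType) (d : nat).
Local Notation E := (euclidean R d).
Local Notation M := (measures E R).

Definition centered_box (m : nat) : set E :=
  [set x | forall i, (`|tnth x i : R| <= m%:R)%R].

Lemma measurable_centered_box m : measurable (centered_box m).
Proof.
rewrite [X in measurable X](_ : _ =
    \bigcap_(i in [set: 'I_d])
      ((fun x : E => tnth x i : R) @^-1` [set` `[(- m%:R)%R, (m%:R : R)%R]])).
  apply: fin_bigcap_measurable => // i _.
  rewrite -[X in measurable X]setTI.
  by apply: measurable_tnth => //; exact: measurable_itv.
apply/seteqP; split => [x h i _ /=|x h i].
  by rewrite in_itv /= -ler_norml.
by have := h i Logic.I; rewrite /= in_itv /= -ler_norml.
Qed.

Lemma centered_boxP (x : E) : exists m, centered_box m x.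
Proof.
exists (Num.bound (\sum_i `|tnth x i : R|)%R) => i.
apply: ltW; apply: le_lt_trans (archi_boundP _); last exact: sumr_ge0.
by rewrite (bigD1 i)//= lerDl sumr_ge0.
Qed.

Lemma simple_point_measure_insertion (mu : M) (x : E) :
  simple_point_measure mu -> (mu : M) [set x] = 0 ->
  simple_point_measure (insertion (mu, x)).
Proof.
move=> [D cD muE] mux.
have NDx : ~ D x.
  move=> Dx; have : 1 <= (mu : M) [set x].
    rewrite muE; last exact: measurable_point.
    apply: esum_ge; exists [set x]; first by split => // y ->.
    by rewrite fsbig_set1 diracE mem_set.
  by rewrite mux lee_fin ler10.
exists ([set x] `|` D) => [|A mA].
  rewrite (_ : _ `|` _ = \bigcup_(b in [set: bool]) if b then [set x] else D).
    by apply: bigcup_countable => // -[].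
  apply/seteqP; split => y /=; first by move=> [|]; [exists true|exists false].
  by move=> [[] _]; [left|right].
rewrite insertionE /= muE// addeC [RHS](esumID [set x]); last first.
  by move=> *; exact: measure_ge0.
rewrite setUK [X in _ = X + _]esum_set1; last exact: measure_ge0.
congr (_ + esum _ _).
apply/seteqP; split => y /=; last by move=> [[]].
by move=> Dy; split; [right|move=> yx; apply: NDx; rewrite -yx].
Qed.

Lemma locally_finite_insertion (mu : M) (x : E) :
  locally_finite mu -> locally_finite (insertion (mu, x)).
Proof.
move=> lf A mA bA; rewrite insertionE /=.
by rewrite lte_add_pinfty//; [exact: lf|rewrite diracE ltry].
Qed.

(** The countably many truncations, by window and by bound on the mass,
    together see all the atoms of a locally finite measure. *)
Lemma independent_atomless_null dO (Omega : measurableType dO)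
    (P : probability Omega R) (X : {mfun Omega >-> M})
    (U : {mfun Omega >-> E}) :
  {ae P, forall w, locally_finite (X w)} -> independent P X U ->
  (forall x, P (U @^-1` [set x]) = 0) ->
  {ae P, forall w, (X w : M) [set U w] = 0}.
Proof.
move=> lfX XU U0.
pose k m b := truncated_restriction (measurable_centered_box m) (b%:R : R).
have k0 m b : {ae P, forall w, k m b (X w, U w) [set U w] = 0}.
  have [mB B0] := truncated_restriction_null (u := distribution P U)
    (measurable_centered_box m) (b%:R : R) (distribution P X) U0.
  have mB' : measurable [set w | k m b (X w, U w) [set U w] != 0].
    rewrite -[X in measurable X]setTI.
    exact: (measurable_fun_pair (measurable_funPT X) (measurable_funPT U)
      measurableT mB).
  have /negligibleP : P [set w | k m b (X w, U w) [set U w] != 0] = 0.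
    by rewrite -[RHS]B0 -(joint_distribution XU mB).
  move=> /(_ mB'); apply: negligibleS => w /= h.
  by apply/eqP => h'; apply: h.
have {}k0 : {ae P, forall w, forall m b, k m b (X w, U w) [set U w] = 0}.
  by apply: ae_foralln => m; apply: ae_foralln => b; exact: k0.
apply: filterS2 lfX k0 => w lf kw.
have [m mU] := centered_boxP (U w).
have Xm : (X w : M) (centered_box m) < +oo.
  by apply: lf; [exact: measurable_centered_box|exists m%:R].
pose b := Num.bound (fine ((X w : M) (centered_box m))).
have Xb : (X w : M) (centered_box m) <= b%:R%:E.
  have Xfin : (X w : M) (centered_box m) \is a fin_num by rewrite ge0_fin_numE.
  by rewrite -(fineK Xfin) lee_fin ltW// archi_boundP// fine_ge0.
have := kw m b; rewrite /k /truncated_restriction /= Xb /= /mrestr.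
by rewrite (_ : _ `&` _ = [set U w])//; apply/seteqP; split => y [] // ->.
Qed.

End point_process_add_point.

(** * Uniform points, and the case of dimension zero *)

Lemma lebesgue_euclidean_point (R : realType) (d : nat) (x : euclidean R d.+1) :
  lebesgue_euclidean R d.+1 [set x] = 0.
Proof.
pose A i : set (measurableTypeR R) := [set tnth x i].
rewrite (_ : [set x] = [set y | forall i, A i (tnth y i)]).
  rewrite (lebesgue_euclidean_box (A := A)) => [|i]; last first.
    exact: measurable_set1.
  by rewrite big_ord_recl lebesgue_measure_set1 mul0e.
apply/seteqP; split => [y /= -> i //|y /= h].
exact: eq_from_tnth.
Qed.

Lemma uniform_on_atomless (R : realType) (d : nat) dO
    (Omega : measurableType dO) (P : probability Omega R)
    (S : set (euclidean R d.+1)) (U : {mfun Omega >-> euclidean R d.+1}) x :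
  measurable S -> uniform_on P S U -> P (U @^-1` [set x]) = 0.
Proof.
move=> mS unifU; rewrite unifU; last exact: measurable_point.
rewrite (_ : lebesgue_euclidean _ _ (_ `&` _) = 0) ?mul0e//.
apply: subset_measure0 (lebesgue_euclidean_point x) => //.
- by apply: measurableI => //; exact: measurable_point.
- exact: measurable_point.
Qed.

Lemma point_process_dimension0_bounded (R : realType) dO
    (Omega : measurableType dO) (P : probability Omega R)
    (X : {mfun Omega >-> measures (euclidean R 0) R}) :
  point_process P X ->
  P [set w | 2%:R%:E <= (X w : measures (euclidean R 0) R) setT] = 0.
Proof.
move=> ppX.
have mA : measurable
    [set w | 2%:R%:E <= (X w : measures (euclidean R 0) R) setT].
  rewrite -[X in measurable X]setTI; apply: emeasurable_fun_c_infty => //.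
  apply: (measurableT_comp (measurable_evaluation measurableT)).
  exact: measurable_funPT.
apply/negligibleP => //; apply: negligibleS ppX => w /= X2 [[D _ XE] _].
move: X2; rewrite XE// leNgt => /negP; apply.
apply: (@le_lt_trans _ _
  (\esum_(x in [set [tuple]]) \d_x [set: euclidean R 0])).
  rewrite [leLHS]esum_mkcond [leRHS]esum_mkcond; apply: le_esum => x _.
  rewrite [X in _ <= if X then _ else _]mem_set; last by rewrite /= tuple0.
  by case: ifP => // _; exact: measure_ge0.
by rewrite esum_set1 ?diracT ?lte_fin ?ltr1n//.
Qed.

(** * Stability of insertion-tolerance under an insertion *)

Theorem lemma10 (R : realType) (d : nat) (dO : measure_display)
    (Omega : measurableType dO) (P : probability Omega R)
    (Pi : {mfun Omega >-> measures (euclidean R d) R})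
    (S : set (euclidean R d)) (U : {mfun Omega >-> euclidean R d}) :
  point_process P Pi ->
  measurable S ->
  0 < lebesgue_euclidean R d S -> lebesgue_euclidean R d S < +oo ->
  insertion_tolerant P Pi ->
  uniform_on P S U ->
  independent P Pi U ->
  point_process P (add_point Pi U) /\ insertion_tolerant P (add_point Pi U).
Proof.
move=> ppPi mS S0 Soo tolPi unifU PiU.
split; last exact: insertion_tolerant_add_point.
case: d Pi S U ppPi mS S0 Soo tolPi unifU PiU
    => [|d] Pi S U ppPi mS S0 Soo tolPi unifU PiU.
  (* On a one-point space a simple point measure has mass at most one. *)
  have := insertion_tolerant_unbounded 2 tolPi mS S0 Soo unifU PiU.
  by rewrite point_process_dimension0_bounded// eqxx.
have PiU0 : {ae P, forall w,
    (Pi w : measures (euclidean R d.+1) R) [set U w] = 0}.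
  apply: independent_atomless_null PiU _ => [|x].
    by apply: filterS ppPi => w [].
  exact: uniform_on_atomless mS unifU.
apply: filterS2 ppPi PiU0 => w [simplePi lfPi] Piw0; split.
  exact: (simple_point_measure_insertion simplePi).
exact: (@locally_finite_insertion _ _ (Pi w) (U w)).
Qed.
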